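(* Let $\mathbf{C}^{\rm P}$ be non-symmetric, i.e. $\mathbf{C}^{\rm P}\neq\mathbf{C}^{\rm M}$. (1) If $\mathbf{r}^{\rm P}(t)$ is normal, then $\mathbf{C}^{\rm M}$ is a real-critical set of $\mathbf{P}(s,t)$. (2) If $\mathbf{r}^{\rm P}(t)$ is not normal, and $(0,b,c)$ is its critical point, then: if $(0,-b,c)\in\mathbf{C}^{\rm P}$, the mirror curve $\mathbf{C}^{\rm M}$ is a real-critical set of $\mathbf{P}(s,t)$; otherwise, $\mathbf{C}^{\rm M}\cup\mathbf{circ}(b,c)$ is a real-critical set of $\mathbf{P}(s,t)$.
   Context: Setting: $p(t),q(t)\in\mathbb{R}(t)$ are rational functions with real coefficients, $p$ is not identically zero and $q$ is not constant. $\mathbf{r}^{\rm P}(t)=(0,p(t),q(t))$ is assumed proper, i.e. injective up to finitely many parameter values (birational onto its image curve). The profile curve $\mathbf{C}^{\rm P}$ is the complex algebraic curve in the $(y,z)$-plane $\{x=0\}\subset\mathbb{C}^3$ parametrized by $\mathbf{r}^{\rm P}$ (the Zariski closure of the image). The mirror curve $\mathbf{C}^{\rm M}$ is the curve parametrized in the same sense by $\mathbf{r}^{\rm M}(t)=(0,-p(t),q(t))$. The surface of revolution $\mathbf{S}\subset\mathbb{C}^3$ generated by rotating $\mathbf{C}^{\rm P}$ around the $z$-axis is the Zariski closure of the image of $$\mathbf{P}(s,t)=\left(\frac{2s}{1+s^2}\,p(t),\frac{1-s^2}{1+s^2}\,p(t),q(t)\right).$$ Parameters take complex values wherever the expressions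 are defined; a point is reachable by a parametrization if it is its value at some such complex parameter(s). Recalled fact: if $f(y,z)=A(y^2,z)+yB(y^2,z)$ is the defining polynomial of $\mathbf{C}^{\rm P}$, then $\mathbf{S}$ is the zero set of $F=A(x^2+y^2,z)$ if $B=0$ (equivalently, if $\mathbf{C}^{\rm P}$ is symmetric), and of $F=A^2(x^2+y^2,z)-(x^2+y^2)B^2(x^2+y^2,z)$ otherwise. $\mathbf{circ}(\alpha,c)$ denotes the circle of radius $|\alpha|$ in the plane $z=c$ centered at $(0,0,c)$, i.e. the curve parametrized as $\left(\frac{2s}{1+s^2}\alpha,\frac{1-s^2}{1+s^2}\alpha,c\right)$; for $\alpha\neq0$ it is $\{(x,y,c)\in\mathbb{C}^3: x^2+y^2=\alpha^2\}$. $\mathbf{r}^{\rm P}$ is normal if every point of $\mathbf{C}^{\rm P}$ is reachable by $\mathbf{r}^{\rm P}(t)$, $t\in\mathbb{C}$. A proper curve parametrization misses at most one point of its curve; if $\mathbf{r}^{\rm P}$ is not normal, the unique missed point is called its critical point, and it equals $\lim_{t\to\infty}\mathbf{r}^{\rm P}(t)$. A real-critical set of $\mathbf{P}$ is a subset of $\mathbf{S}$ of dimension smaller than 2 containing every point of $\mathbf{S}\cap\mathbb{R}^3$ that is not reachable by $\mathbf{P}$. *)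

(* Defs.v *)
From HB Require Import structures.
From mathcomp Require Import all_boot all_order all_algebra.
From mathcomp Require Import boolp classical_sets reals.
From mathcomp Require Import complex.
From mathcomp Require mpoly.

Set Implicit Arguments.
Unset Strict Implicit.
Unset Printing Implicit Defensive.

Import Order.TTheory GRing.Theory Num.Theory.

Local Open Scope ring_scope.
Local Open Scope complex_scope.
Local Open Scope classical_set_scope.

Section ZariskiTopology.
Variable K : fieldType.

Definition vanishes_at (f : mpoly.mpoly 3 K) (P : 3.-tuple K) : Prop :=
  mpoly.meval (tnth P) f = 0.

Definition zero_locus (I : set (mpoly.mpoly 3 K)) : set (3.-tuple K) :=
  [set P | forall f, I f -> vanishes_at f P].

Definition vanishing_ideal (X : set (3.-tuple K)) : set (mpoly.mpoly 3 K) :=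
  [set f | forall P, X P -> vanishes_at f P].

Definition zariski_closed (X : set (3.-tuple K)) : Prop :=
  exists I, X = zero_locus I.

Definition zariski_closure (X : set (3.-tuple K)) : set (3.-tuple K) :=
  zero_locus (vanishing_ideal X).

Definition irreducible_closed (X : set (3.-tuple K)) : Prop :=
  [/\ zariski_closed X, X !=set0
    & forall Y Z, zariski_closed Y -> zariski_closed Z ->
        X `<=` Y `|` Z -> X `<=` Y \/ X `<=` Z].

(* The dimension of [X] is the Krull dimension of its Zariski closure, i.e. the
   supremum of the [n] admitting a chain [Z 0 < ... < Z n] of irreducible closed
   subsets of the closure; it is smaller than [n] iff there is no chain of
   length [n]. *)
Definition dim_lt (n : nat) (X : set (3.-tuple K)) : Prop :=
  ~ exists Z : nat -> set (3.-tuple K),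
      [/\ forall i, (i <= n)%N -> irreducible_closed (Z i),
          forall i, (i < n)%N -> Z i `<` Z i.+1
        & Z n `<=` zariski_closure X].

End ZariskiTopology.

Section SurfaceOfRevolution.
Variable R : realType.
Local Notation C := R[i].
Local Notation ratfun := {fraction {poly R}}.

Definition horner_cpx (a : {poly R}) (t : C) : C :=
  (map_poly (real_complex R) a).[t].

(* [f] is defined at [t], with value [v]. Since some fraction representing [f]
   must have a denominator not vanishing at [t], the parameters where [f] is
   undefined are the roots of its denominator in lowest terms. *)
Definition ratfun_value (f : ratfun) (t v : C) : Prop :=
  exists a b : {poly R},
    [/\ horner_cpx b t != 0, f = tofrac a / tofrac b
      & v = horner_cpx a t / horner_cpx b t].

Definition ratfun_const (f : ratfun) : Prop := exists k : R, f = tofrac k%:P.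

Definition profile_point (p q : ratfun) (t : C) (P : 3.-tuple C) : Prop :=
  exists y z : C,
    [/\ ratfun_value p t y, ratfun_value q t z & P = [tuple 0; y; z]].

Definition profile_reachable (p q : ratfun) : set (3.-tuple C) :=
  [set P | exists t, profile_point p q t P].

Definition profile_proper (p q : ratfun) : Prop :=
  exists E : seq C, forall (t1 t2 : C) (P : 3.-tuple C),
    t1 \notin E -> t2 \notin E ->
    profile_point p q t1 P -> profile_point p q t2 P -> t1 = t2.

Definition profile_curve (p q : ratfun) : set (3.-tuple C) :=
  zariski_closure (profile_reachable p q).

Definition mirror_curve (p q : ratfun) : set (3.-tuple C) :=
  profile_curve (- p) q.

Definition rotate (s y z : C) : 3.-tuple C :=
  [tuple 2 * s / (1 + s ^+ 2) * y; (1 - s ^+ 2) / (1 + s ^+ 2) * y; z].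

Definition revolution_reachable (p q : ratfun) : set (3.-tuple C) :=
  [set P | exists s t y z : C,
    [/\ 1 + s ^+ 2 != 0, ratfun_value p t y, ratfun_value q t z
      & P = rotate s y z]].

Definition revolution_surface (p q : ratfun) : set (3.-tuple C) :=
  zariski_closure (revolution_reachable p q).

(* The closure adds the point [(0, - alpha, c)], which no parameter reaches when
   [alpha != 0]. *)
Definition circ (alpha c : C) : set (3.-tuple C) :=
  zariski_closure [set P | exists s, 1 + s ^+ 2 != 0 /\ P = rotate s alpha c].

Definition profile_normal (p q : ratfun) : Prop :=
  profile_curve p q `<=` profile_reachable p q.

(* A missed point is automatically unique (it can only be the limit at infinity),
   so uniqueness is not part of the definition. *)
Definition critical_point (p q : ratfun) (P : 3.-tuple C) : Prop :=
  profile_curve p q P /\ ~ profile_reachable p q P.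

Definition real_critical_set (p q : ratfun) (X : set (3.-tuple C)) : Prop :=
  [/\ X `<=` revolution_surface p q, dim_lt 2 X
    & forall x y z : R,
        let P := [tuple x%:C; y%:C; z%:C] in
        revolution_surface p q P -> ~ revolution_reachable p q P -> X P].

End SurfaceOfRevolution.

(* Main.v *)
Require Import Defs.
From mathcomp Require Import all_boot all_order all_algebra.
From mathcomp Require Import boolp classical_sets reals.
From mathcomp Require Import complex.
From mathcomp Require Import generic_quotient mpoly ring.

Set Implicit Arguments.
Unset Strict Implicit.
Unset Printing Implicit Defensive.

Import GRing.Theory Num.Theory.

Local Open Scope ring_scope.
Local Open Scope complex_scope.
Local Open Scope classical_set_scope.

(** Why the theorem holds.

    Cut the surface S along the meridian plane x = 0.  If a polynomial f
    vanishes on the profile curve, then f(r, z) f(- r, z) is even in r, hence a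
    polynomial in r^2 and z; replacing r^2 by x^2 + y^2 gives an equation of S.
    So a point (x, y, z) of S with x^2 + y^2 = r^2 lies over (0, r, z) or
    (0, - r, z) in the profile curve ([revolution_section]).

    Fix such a point, real and not reached, with (0, r, z) on the profile
    curve.  If r = 0, then x = y = 0 because x and y are real, and the point is
    on the axis, where both meridian curves agree.  If r <> 0, the rational
    parametrization of the circle reaches everything but (0, - r, z)
    ([rotate_covers]), and that point lies on the mirror curve.  So off the
    mirror curve (0, r, z) itself must be missed by the profile
    parametrization ([unreached_on_mirror]).

    A rational curve misses at most one point, its limit at infinity
    ([missed_point_at_infinity]).  Hence a normal profile leaves only the mirror
    curve; otherwise (r, z) = (b, c), and the circle [circ b c] has to be added
    unless (0, - b, c) is on the profile curve: that point is then reached, and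
    the same argument with - r in place of r puts the given point on the mirror
    curve.

    The same lemma on missed points controls the dimension: a proper closed
    subset of a parametrized curve is the zero set of some equation not
    vanishing identically along it, so only finitely many parameters, plus
    possibly the missed point, contribute.  A chain of irreducible sets in such a
    curve therefore has at most two terms ([curve_chain_free]).

    The missed points are treated by Nakayama's determinant trick.  Let the
    curve be A_i / D and let P be a point which is neither reached nor the limit
    at infinity.  Then the U_i = A_i - P_i D have no common zero, one of them has
    the maximal degree, and Bezout relations with degree bounds express every
    D t^j as a combination of the U_i whose coefficients are again polynomials of
    bounded degree.  Divided by D, this says that the vector of the powers of t
    is killed by 1 - sum_i (X_i - P_i) M_i on the curve, for constant matrices
    M_i.  The determinant of this matrix vanishes on the curve and equals 1 at
    P, so P is not in the closure. *)

(** * Polynomials generated by constants and variables *)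

Lemma mpoly_generated_ind (n : nat) (K : nzRingType)
    (Q : {mpoly K[n]} -> Prop) :
    (forall c, Q c%:MP) -> (forall i, Q 'X_i) ->
    (forall f g, Q f -> Q g -> Q (f + g)) ->
    (forall f g, Q f -> Q g -> Q (f * g)) ->
  forall f, Q f.
Proof.
move=> Qc QX QD QM f.
have Q0 : Q 0 by rewrite -mpolyC0; apply: Qc.
have Q1 : Q 1 by rewrite -mpolyC1; apply: Qc.
rewrite (mpolyE f); apply: (big_ind Q Q0 QD) => m _.
rewrite -mul_mpolyC; apply: (QM) => //; rewrite mpolyXE_id.
apply: (big_ind Q Q1 QM) => i _.
elim: (m i) => [|k IHk]; first by rewrite expr0.
by rewrite exprS; apply: QM.
Qed.

(** * Zariski closed sets in affine 3-space *)

Section ZariskiBasics.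
Variable K : fieldType.
Implicit Types (X Y : set (3.-tuple K)) (P : 3.-tuple K).

Lemma sub_zariski_closure X : X `<=` zariski_closure X.
Proof. by move=> P XP f; apply. Qed.

Lemma zariski_closure_closed X : zariski_closed (zariski_closure X).
Proof. by exists (vanishing_ideal X). Qed.

Lemma zariski_closure_sub X Y :
  zariski_closed Y -> X `<=` Y -> zariski_closure X `<=` Y.
Proof.
move=> [I ->] XY P XP f If; apply: XP => Q XQ; exact: XY XQ f If.
Qed.

(** The products f g, with f in one ideal and g in the other, cut out the
    union. *)
Lemma zariski_closed_setU X Y :
  zariski_closed X -> zariski_closed Y -> zariski_closed (X `|` Y).
Proof.
move=> [I ->] [J ->].
exists [set h | exists f g, [/\ I f, J g & h = f * g]].
rewrite eqEsubset; split=> P.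
  move=> [IP|JP] _ [f [g [If Jg ->]]]; rewrite /vanishes_at mevalM.
    by rewrite (IP _ If) mul0r.
  by rewrite (JP _ Jg) mulr0.
move=> IJP; apply: contrapT => /not_orP[/existsNP[f /not_implyP[If fP]]].
move=> /existsNP[g /not_implyP[Jg gP]].
have /eqP : vanishes_at (f * g) P by apply: IJP; exists f, g.
by rewrite mevalM mulf_eq0 => /orP[]/eqP.
Qed.

Lemma zariski_closed_set1 P : zariski_closed [set P].
Proof.
exists [set f | exists i, f = 'X_i - (tnth P i)%:MP].
rewrite eqEsubset; split=> Q.
  by move=> -> _ [i ->]; rewrite /vanishes_at mevalB mevalXU mevalC subrr.
move=> PQ; apply: eq_from_tnth => i; apply/eqP; rewrite -subr_eq0; apply/eqP.
have := PQ ('X_i - (tnth P i)%:MP).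
by rewrite /vanishes_at mevalB mevalXU mevalC; apply; exists i.
Qed.

(** Polynomial maps are continuous: equations pull back by composition. *)
Lemma zariski_closure_image (g : 3.-tuple {mpoly K[3]}) X Y P :
    (forall Q, X Q -> Y [tuple (tnth g i).@[tnth Q] | i < 3]) ->
  zariski_closure X P ->
  zariski_closure Y [tuple (tnth g i).@[tnth P] | i < 3].
Proof.
move=> gXY XP f Yf; rewrite /vanishes_at.
have eg Q : f.@[tnth [tuple (tnth g i).@[tnth Q] | i < 3]]
            = (f \mPo g).@[tnth Q].
  by rewrite comp_mpoly_meval; apply: meval_eq => i; rewrite tnth_mktuple.
by rewrite eg; apply: XP => Q XQ; rewrite /vanishes_at -eg; apply/Yf/gXY.
Qed.

(** Points are closed, so they can be split off a finite set one at a time. *)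
Lemma irreducible_finite (s : seq (3.-tuple K)) X :
  irreducible_closed X -> X `<=` [set` s] -> exists P, X = [set P].
Proof.
move=> [_ [P0 XP0] irrX]; elim: s => [/(_ _ XP0)//|P s IHs] Xs.
have [|XP] := pselect (~ X `<=` [set P]); last first.
  exists P; rewrite eqEsubset; split; first exact: contrapT.
  have /contrapT XsubP := XP.
  by move=> Q ->; rewrite -(XsubP _ XP0).
move=> XnP; apply: IHs.
have cs : zariski_closed [set` s].
  elim: s {Xs} => [|Q s cs].
    exists [set 1]; rewrite eqEsubset; split=> // Q /(_ _ erefl).
    by rewrite /vanishes_at meval1 => /eqP; rewrite oner_eq0.
  suff -> : [set` Q :: s] = [set Q] `|` [set` s].
    by apply: zariski_closed_setU => //; exact: zariski_closed_set1.
  rewrite eqEsubset; split=> S; rewrite /= in_cons.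
      by case/predU1P; [left|right].
  by case=> [->|->]; rewrite ?eqxx ?orbT.
have [|//|//] := irrX _ _ (zariski_closed_set1 P) cs.
move=> S /Xs; rewrite /= in_cons => /predU1P[]; by [left|right].
Qed.

(** Holds when X has dimension at most 1: an irreducible closed set strictly
    inside X has no room for a smaller one. *)
Definition chain_free (X : set (3.-tuple K)) : Prop :=
  forall Z0 Z1, irreducible_closed Z0 -> irreducible_closed Z1 ->
    Z0 `<` Z1 -> ~ Z1 `<` X.

(** The top of a chain of length 2 is irreducible, hence inside X or inside Y,
    and the two smaller terms contradict the assumption on that set. *)
Lemma dim_lt2_setU X Y :
    zariski_closed X -> zariski_closed Y -> chain_free X -> chain_free Y ->
  dim_lt 2 (X `|` Y).
Proof.
move=> cX cY fX fY [Z [irrZ ltZ Z2]].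
have Z01 := ltZ 0%N isT; have [Z12 Z21] := ltZ 1%N isT.
have irr0 := irrZ 0%N isT; have irr1 := irrZ 1%N isT.
have sub T : Z 2 `<=` T -> Z 1%N `<` T.
  by move=> ZT; split=> [|TZ]; [move=> S /Z12/ZT | apply: Z21 => S /ZT/TZ].
have [_ _ irr2] := irrZ 2 isT.
have Z2XY : Z 2 `<=` X `|` Y.
  move=> S /Z2; apply: zariski_closure_sub => //.
  exact: zariski_closed_setU.
have [/sub|/sub] := irr2 _ _ cX cY Z2XY.
  exact: fX irr0 irr1 Z01.
exact: fY irr0 irr1 Z01.
Qed.

End ZariskiBasics.

(** * Bezout relations with degree bounds *)

Lemma bezout_common_divisor (F : fieldType) (n : nat) (U : 'I_n -> {poly F}) :
  exists a : 'I_n -> {poly F}, forall i, \sum_j a j * U j %| U i.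
Proof.
elim: n U => [|n IHn] U; first by exists (fun=> 0) => -[].
have [a aP] := IHn (fun i => U (lift ord0 i)).
set g := \sum_j a j * _ in aP.
have [[u v] /= uvE] := Bezoutp (U ord0) g.
exists (fun i => if unlift ord0 i is Some j then v * a j else u) => i.
rewrite big_ord_recl unlift_none.
under eq_bigr => j _ do rewrite liftK -mulrA.
rewrite -big_distrr -/g /= (eqp_dvdl _ uvE).
case: (unliftP ord0 i) => [j ->|->]; last exact: dvdp_gcdl.
exact: dvdp_trans (dvdp_gcdr _ _) (aP j).
Qed.

Section Bezout.
Variable K : closedFieldType.

Lemma bezout_no_common_root (n : nat) (U : 'I_n -> {poly K}) :
    (forall t, exists i, (U i).[t] != 0) ->
  exists a : 'I_n -> {poly K}, \sum_j a j * U j = 1.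
Proof.
move=> U_nz; have [a aP] := bezout_common_divisor U; set g := \sum_j _ in aP.
have /size_poly1P[c c0 gE] : size g == 1%N.
  apply/contraT => /closed_rootP[t gt0]; have [j] := U_nz t.
  by rewrite -[_ == 0]/(root (U j) t) (root_dvdp (aP j)).
exists (fun j => c^-1%:P * a j).
under eq_bigr => j _ do rewrite -mulrA.
by rewrite -big_distrr -/g /= gE -polyCM mulVf.
Qed.

(** Bezout with degree bounds: reduce the coefficients of all U_i but one of
    maximal degree n modulo that one; comparing degrees then bounds the
    remaining coefficient too. *)
Lemma bezout_size (n m : nat) (U : 'I_m -> {poly K}) (i0 : 'I_m)
    (G : {poly K}) :
    (forall t, exists i, (U i).[t] != 0) ->
    size (U i0) = n.+1 -> (forall i, (size (U i) <= n.+1)%N) ->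
    (size G <= (n + n).+1)%N ->
  exists w : 'I_m -> {poly K},
    (forall i, (size (w i) <= n.+1)%N) /\ G = \sum_i w i * U i.
Proof.
move=> U_nz sU0 sU sG; have [a aE] := bezout_no_common_root U_nz.
have U0_neq0 : U i0 != 0 by rewrite -size_poly_eq0 sU0.
pose w i := if i == i0
  then G * a i0 + \sum_(j | j != i0) U j * ((G * a j) %/ U i0)
  else (G * a i) %% U i0.
have swi i : i != i0 -> (size (w i) <= n)%N.
  by move=> /negbTE ni; rewrite /w ni -ltnS -sU0 ltn_modp.
have wE : G = \sum_i w i * U i.
  rewrite -[LHS]mulr1 -aE big_distrr (bigD1 i0) //= [RHS](bigD1 i0) //=.
  rewrite {1}/w eqxx mulrDl big_distrl /= mulrA -addrA; congr (_ + _).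
  rewrite -big_split; apply: eq_bigr => i /negbTE ni /=.
  by rewrite /w ni mulrA {1}(divp_eq (G * a i) (U i0)); ring.
exists w; split=> // i.
have [->{i}|/swi/leqW//] := eqVneq i i0.
have w0E : w i0 * U i0 = G - \sum_(i | i != i0) w i * U i.
  by rewrite {1}wE (bigD1 i0) //= addrK.
have sw0 : (size (w i0 * U i0)%R <= (n + n).+1)%N.
  rewrite w0E (leq_trans (size_polyD _ _)) // geq_max sG size_polyN.
  rewrite (leq_trans (size_sum _ _ _)) //; apply/bigmax_leqP => i /swi swin.
  rewrite (leq_trans (size_polyMleq _ _)) // -subn1 leq_subLR.
  by rewrite (leq_trans (leq_add swin (sU i))) // addnS add1n ltnS leqnSn.
have [->|w0_neq0] := eqVneq (w i0) 0; first by rewrite size_poly0.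
by move: sw0; rewrite size_mul // sU0 addnS /= -addSn leq_add2r.
Qed.

End Bezout.

(** * Rational curves and their missed points *)

Section RationalCurve.
Variables (K : closedFieldType) (A : 'I_3 -> {poly K}) (D : {poly K}).

Definition curve_point (t : K) : 3.-tuple K :=
  [tuple (A i).[t] / D.[t] | i < 3].

Definition curve_image : set (3.-tuple K) :=
  [set P | exists2 t, D.[t] != 0 & P = curve_point t].

(** Clearing denominators: along the curve, a polynomial equation becomes a
    polynomial equation in the parameter. *)
Lemma meval_curve_point (f : {mpoly K[3]}) :
  exists k h, forall t, D.[t] != 0 ->
    h.[t] = D.[t] ^+ k * f.@[tnth (curve_point t)].
Proof.
elim/mpoly_generated_ind: f =>
  [c|i|f g [k [h hE]] [l [e eE]]|f g [k [h hE]] [l [e eE]]].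
- by exists 0%N, c%:P => t _; rewrite hornerC mevalC mul1r.
- exists 1%N, (A i) => t Dt.
  by rewrite mevalXU tnth_mktuple mulrC divfK.
- exists (k + l)%N, (h * D ^+ l + e * D ^+ k) => t Dt.
  by rewrite !hornerE hE // eE // mevalD exprD; ring.
- exists (k + l)%N, (h * e) => t Dt.
  by rewrite hornerM hE // eE // mevalM exprD; ring.
Qed.

Lemma curve_vanish_or_finite (f : {mpoly K[3]}) : D != 0 ->
  (forall t, D.[t] != 0 -> f.@[tnth (curve_point t)] = 0) \/
  (exists s : seq K, forall t, D.[t] != 0 ->
     f.@[tnth (curve_point t)] = 0 -> t \in s).
Proof.
move=> D0; have [k [h hE]] := meval_curve_point f.
have [h0|h_neq0] := eqVneq h 0.
  left=> t Dt; have := hE t Dt; rewrite h0 horner0 => /esym/eqP.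
  by rewrite mulf_eq0 expf_eq0 (negbTE Dt) andbF /= => /eqP.
right; have [s hs] := closed_field_poly_normal h.
exists s => t Dt ft.
have : root h t by rewrite /root hE // ft mulr0.
by rewrite hs rootZ ?lead_coef_eq0 // root_prod_XsubC.
Qed.

(** Finitely many parameters can be dropped without changing the closure. *)
Lemma vanish_cofinite (f : {mpoly K[3]}) (s : seq K) : D != 0 ->
    (forall t, t \notin s -> D.[t] != 0 -> f.@[tnth (curve_point t)] = 0) ->
  forall t, D.[t] != 0 -> f.@[tnth (curve_point t)] = 0.
Proof.
move=> D0 fs; have [//|[s' s'P]] := curve_vanish_or_finite f D0.
have : D * \prod_(a <- s ++ s') ('X - a%:P) != 0.
  by rewrite mulf_neq0 // monic_neq0 // monic_prod_XsubC.
move=> /closed_nonrootP[t]; rewrite rootM root_prod_XsubC mem_cat !negb_or.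
move=> /and3P[Dt ts ts']; have := s'P t Dt (fs t ts Dt).
by rewrite (negbTE ts').
Qed.

Hypothesis D_neq0 : D != 0.
Hypothesis no_base : forall t, D.[t] = 0 -> exists i, (A i).[t] != 0.

(** The right-hand side is the limit of the parametrization at infinity, so a
    missed point is unique.  The determinant trick sketched at the top, with n
    the maximal degree of the A_i - P_i D, excludes any other missed point. *)
Lemma missed_point_at_infinity (P : 3.-tuple K) :
    zariski_closure curve_image P -> ~ curve_image P ->
  P = [tuple (A i)`_(size D).-1 / lead_coef D | i < 3].
Proof.
move=> clP nP; pose U i := A i - (tnth P i)%:P * D.
have U_nz t : exists i, (U i).[t] != 0.
  have [Dt|Dt] := eqVneq D.[t] 0.
    have [i Ai] := no_base Dt; exists i.
    by rewrite /U !hornerE Dt mulr0 subr0.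
  apply: contrapT => /forallNP U0; apply: nP; exists t => //.
  apply: eq_from_tnth => i; rewrite tnth_mktuple; apply/eqP.
  have /negP := U0 i; rewrite negbK /U !hornerE subr_eq0 => /eqP ->.
  by rewrite mulfK.
(* All U_i of smaller degree than D: then P_i is the quotient of the leading
   terms. *)
have [sU|] := pselect (forall i, (size (U i) < size D)%N).
  apply: eq_from_tnth => i; rewrite tnth_mktuple.
  have : (U i)`_(size D).-1 = 0.
    by apply: nth_default; rewrite -ltnS prednK ?size_poly_gt0.
  rewrite /U coefB coefCM -/(lead_coef D) => /eqP; rewrite subr_eq0 => /eqP ->.
  by rewrite mulfK // lead_coef_eq0.
(* Otherwise some U_i dominates, and the Bezout relations are available. *)
move=> /existsNP[i1 /negP]; rewrite -leqNgt => sD1; exfalso.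
pose i0 := [arg max_(i > i1) size (U i)].
have [sDU sU] : (size D <= size (U i0))%N
    /\ forall i, (size (U i) <= size (U i0))%N.
  rewrite /i0; case: arg_maxnP => // i _ imax.
  by split=> [|j]; [exact: leq_trans (imax i1 _) | exact: imax].
have [n sU0] : exists n, size (U i0) = n.+1.
  exists (size (U i0)).-1.
  by rewrite prednK // (leq_trans _ sDU) ?size_poly_gt0.
rewrite sU0 in sDU sU.
have /boolp.choice[w wP] : forall j : 'I_n.+1, exists w : 'I_3 -> {poly K},
    (forall i, (size (w i) <= n.+1)%N) /\ D * 'X^j = \sum_i w i * U i.
  move=> j; apply: bezout_size U_nz sU0 sU _.
  by rewrite size_mulXn // -addnS leq_add // -ltnS.
pose M i : 'M[K]_n.+1 := \matrix_(k, j) (w j i)`_k.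
pose N : 'M[{mpoly K[3]}]_n.+1 :=
  1%:M - \sum_i ('X_i - (tnth P i)%:MP) *: map_mx (@mpolyC 3 K) (M i).
have NE (Q : 3.-tuple K) : (\det N).@[tnth Q]
    = \det (1%:M - \sum_i (tnth Q i - tnth P i) *: M i).
  rewrite -(det_map_mx (meval (tnth Q))); congr (\det _).
  apply/matrixP => k j; rewrite !mxE rmorphB !summxE rmorph_sum /=.
  congr (_ - _); first by case: eqP => _; rewrite ?meval1 ?meval0.
  by apply: eq_bigr => i _; rewrite !mxE mevalM mevalB mevalXU !mevalC.
(* On the curve the row (1, t, ..., t^n) is in the kernel of N. *)
have: (\det N).@[tnth P] = 0.
  apply: clP => _ [t Dt ->]; rewrite /vanishes_at NE; apply/eqP/det0P.
  exists (\row_(k < n.+1) t ^+ k).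
    apply/eqP => /matrixP/(_ ord0 ord0); rewrite !mxE expr0 => /eqP.
    by rewrite oner_eq0.
  rewrite mulmxBr mulmx1 mulmx_sumr; apply/matrixP => k j.
  rewrite !mxE summxE; apply/eqP; rewrite subr_eq0; apply/eqP.
  have [sw DXj] := wP j.
  apply: (mulfI Dt); have := congr1 (horner^~ t) DXj.
  rewrite hornerM hornerXn => ->; rewrite horner_sum mulr_sumr.
  apply: eq_bigr => i _; rewrite -scalemxAr !mxE tnth_mktuple hornerM.
  rewrite (horner_coef_wide _ (sw i)).
  under [in RHS]eq_bigr => l _ do rewrite !mxE mulrC.
  by rewrite /U !hornerE /=; set W := \sum_(_ < _) _; field.
rewrite NE; under eq_bigr => i _ do rewrite subrr scale0r.
by rewrite big1 // subr0 det1 => /eqP; rewrite oner_eq0.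
Qed.

Lemma proper_closed_finite (Z : set (3.-tuple K)) :
    zariski_closed Z -> Z `<` zariski_closure curve_image ->
  exists s : seq (3.-tuple K), Z `<=` [set` s].
Proof.
move=> [I ->] [Zsub /existsNP[P /not_implyP[clP]]].
move=> /existsNP[f /not_implyP[If fP]].
have [f0|[s sP]] := curve_vanish_or_finite f D_neq0.
  by case: fP; apply: clP => _ [t Dt ->]; apply: f0.
exists ([tuple (A i)`_(size D).-1 / lead_coef D | i < 3]
        :: map curve_point s).
move=> Q ZQ; rewrite /= in_cons.
have [[t Dt QE]|nQ] := pselect (curve_image Q).
  by rewrite orbC QE map_f // sP // -QE; apply: ZQ.
by rewrite -(missed_point_at_infinity (Zsub _ ZQ) nQ) eqxx.
Qed.

Lemma curve_chain_free : chain_free (zariski_closure curve_image).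
Proof.
move=> Z0 Z1 [_ [P Z0P] _] irr1 [Z01 Z10] Z1C.
have [cZ1 _ _] := irr1; have [s Z1s] := proper_closed_finite cZ1 Z1C.
have [Q Z1Q] := irreducible_finite irr1 Z1s.
by apply: Z10 => S; move: (Z01 _ Z0P); rewrite Z1Q => /= <- ->.
Qed.

End RationalCurve.

(** * Lowest common denominators *)

Lemma fraction_repr (T : idomainType) (f : {fraction T}) :
  exists2 ab : T * T, ab.2 != 0 & f = tofrac ab.1 / tofrac ab.2.
Proof.
elim/quotW: f => x; exists (frac x) => [|/=]; first exact: denom_ratioP.
have dx0 : tofrac (frac x).2 != 0 :> {fraction T}.
  by rewrite tofrac_eq0 denom_ratioP.
apply: (mulIf dx0); rewrite divfK // !piE; apply/eqmodP.
rewrite /= FracField.equivfE /FracField.mulf.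
by rewrite !numden_Ratio ?mulf_neq0 ?oner_eq0 ?denom_ratioP // !mulr1 mulrC.
Qed.

Section CommonDenominator.
Variables (F : fieldType) (p q : {fraction {poly F}}).

Definition common_denom (A B D : {poly F}) :=
  [/\ D != 0, p * tofrac D = tofrac A & q * tofrac D = tofrac B].

Lemma common_denom_ex : exists A B D, common_denom A B D.
Proof.
have [[a b] /= b0 pE] := fraction_repr p.
have [[c d] /= d0 qE] := fraction_repr q.
exists (a * d), (b * c), (b * d); split; first exact: mulf_neq0.
  by rewrite pE !tofracM mulrA divfK ?tofrac_eq0.
by rewrite qE !tofracM mulrCA divfK ?tofrac_eq0.
Qed.

(** The common denominators of p and q form an ideal; a nonzero one of least
    degree generates it. *)
Lemma least_common_denom : exists A B D, common_denom A B D /\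
  forall A' B' D', common_denom A' B' D' -> D %| D'.
Proof.
pose sz n := `[< exists A B D, common_denom A B D /\ size D = n >].
have sz_ex : exists n, sz n.
  have [A [B [D ABD]]] := common_denom_ex.
  by exists (size D); apply/asboolP; exists A, B, D.
have [n /asboolP[A [B [D [ABD sD]]]] nmin] := ex_minnP sz_ex.
exists A, B, D; split=> // A' B' D' [D'0 pD' qD'].
rewrite /dvdp; apply: contraT => r0.
have [D0 pD qD] := ABD; set r := D' %% D in r0; set k := D' %/ D.
have rE : r = D' - k * D by rewrite {1}(divp_eq D' D) addrC addKr.
have /nmin : sz (size r).
  apply/asboolP; exists (A' - k * A), (B' - k * B), r; split=> //; split=> //.
    by rewrite rE !tofracB !tofracM mulrBr pD' mulrCA pD.
  by rewrite rE !tofracB !tofracM mulrBr qD' mulrCA qD.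
by rewrite -sD leqNgt ltn_modp D0.
Qed.

(** Dividing out a common factor of A, B and D would give a smaller
    denominator. *)
Lemma least_common_denom_coprime (A B D : {poly F}) : common_denom A B D ->
    (forall A' B' D', common_denom A' B' D' -> D %| D') ->
  size (gcdp (gcdp A B) D) = 1%N.
Proof.
move=> [D0 pD qD] Dmin; set g := gcdp _ D.
have gAB : g %| gcdp A B by exact: dvdp_gcdl.
have /divpK AE := dvdp_trans gAB (dvdp_gcdl _ _).
have /divpK BE := dvdp_trans gAB (dvdp_gcdr _ _).
have /divpK DE : g %| D by exact: dvdp_gcdr.
have g0 : g != 0 by rewrite gcdp_eq0 negb_and D0 orbT.
have D1_0 : D %/ g != 0 by apply: contraNneq D0 => D1; rewrite -DE D1 mul0r.
have gI : injective (fun x : {fraction {poly F}} => x * tofrac g).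
  by apply: mulIf; rewrite tofrac_eq0.
have /dvdp_leq : D %| D %/ g.
  apply: (Dmin (A %/ g) (B %/ g)); split=> //; apply: gI => /=.
    by rewrite -mulrA -!tofracM DE AE.
  by rewrite -mulrA -!tofracM DE BE.
move=> /(_ D1_0); rewrite -{1}DE size_mul // => le.
have sD1 : (0 < size (D %/ g)%R)%N by rewrite size_poly_gt0.
have sg : (0 < size g)%N by rewrite size_poly_gt0.
apply/eqP; rewrite eqn_leq sg andbT.
by move: le; rewrite -subn1 leq_subLR addnC leq_add2r.
Qed.

End CommonDenominator.

(** * Coordinates, parity and circles *)

Lemma eq_tuple3 (T : Type) (P : 3.-tuple T) (a b c : T) :
    tnth P ord0 = a -> tnth P (inord 1) = b -> tnth P (inord 2) = c ->
  P = [tuple a; b; c].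
Proof.
move=> <- <- <-; apply: eq_from_tnth => -[[|[|[|//]]] i3];
  rewrite [RHS](tnth_nth a) /=; congr (tnth _ _); apply/val_inj => //=;
  by rewrite inordK.
Qed.

Lemma curve_point3 (K : closedFieldType) (A1 A2 A3 D : {poly K}) (t : K) :
  curve_point (tnth [tuple A1; A2; A3]) D t
  = [tuple A1.[t] / D.[t]; A2.[t] / D.[t]; A3.[t] / D.[t]].
Proof.
by apply: eq_tuple3; rewrite tnth_mktuple (tnth_nth 0) ?inordK.
Qed.

(** Splitting f(0, r, z) into its even and odd parts in r, and writing the even
    powers of r through x^2 + y^2. *)
Lemma mpoly_even_odd (K : comNzRingType) (f : {mpoly K[3]}) :
  exists a b : {mpoly K[3]}, forall x y z r : K, r ^+ 2 = x ^+ 2 + y ^+ 2 ->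
    f.@[tnth [tuple 0; r; z]]
    = a.@[tnth [tuple x; y; z]] + r * b.@[tnth [tuple x; y; z]].
Proof.
elim/mpoly_generated_ind: f => [c|i|f g [a [b fE]] [a' [b' gE]]
    |f g [a [b fE]] [a' [b' gE]]].
- by exists c%:MP, 0 => x y z r _; rewrite !mevalC mulr0 addr0.
- case: i => [[|[|[|//]]] i3].
  + exists 0%:MP, 0%:MP => x y z r _.
    by rewrite mevalXU !mevalC mulr0 addr0 (tnth_nth 0).
  + exists 0%:MP, 1%:MP => x y z r _.
    by rewrite mevalXU !mevalC mulr1 add0r (tnth_nth 0).
  + exists 'X_(inord 2), 0 => x y z r _.
    by rewrite !mevalXU meval0 mulr0 addr0 !(tnth_nth 0) /= inordK.
- exists (a + a'), (b + b') => x y z r rE.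
  by rewrite !mevalD (fE x y z r rE) (gE x y z r rE); ring.
- exists (a * a' + ('X_ord0 ^+ 2 + 'X_(inord 1) ^+ 2) * b * b'),
    (a * b' + b * a').
  move=> x y z r rE; rewrite !(mevalD, mevalM, rmorphXn) !mevalXU.
  rewrite !(tnth_nth 0) inordK //=.
  by rewrite -rE (fE x y z r rE) (gE x y z r rE); ring.
Qed.

(** The pole of a circle, where rational parametrization fails. *)
Lemma circle_pole (K : idomainType) (x y r : K) :
  r ^+ 2 = x ^+ 2 + y ^+ 2 -> y = - r -> x = 0.
Proof.
move=> rE yr; apply/eqP; rewrite -sqrf_eq0.
by rewrite -[x ^+ 2](addrK (y ^+ 2)) -rE yr sqrrN subrr.
Qed.

(** * Profile curves, circles and the surface of revolution *)

Section Revolution.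
Variable R : realType.
Local Notation C := R[i].
Local Notation ratfun := {fraction {poly R}}.
Implicit Types (p q : ratfun) (x y z r t : C).

Lemma ratfun_valueN p t y : ratfun_value p t y -> ratfun_value (- p) t (- y).
Proof.
move=> [a [b [bt -> ->]]]; exists (- a), b; split=> //.
  by rewrite tofracN mulNr.
by rewrite /horner_cpx rmorphN hornerN mulNr.
Qed.

(** In lowest terms, D vanishes exactly where p or q is undefined, and there A or
    B does not vanish: the profile is a curve to which
    [missed_point_at_infinity] applies. *)
Lemma profile_param p q : exists A B D : {poly C},
  [/\ D != 0,
      forall t, D.[t] = 0 -> exists i, (tnth [tuple 0; A; B] i).[t] != 0
    & profile_reachable p q = curve_image (tnth [tuple 0; A; B]) D].
Proof.
have [A [B [D [ABD Dmin]]]] := least_common_denom p q.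
have cop := least_common_denom_coprime ABD Dmin; have [D0 pD qD] := ABD.
have hcM (a b : {poly R}) t :
    horner_cpx (a * b) t = horner_cpx a t * horner_cpx b t.
  by rewrite /horner_cpx rmorphM hornerM.
have tD0 : tofrac D != 0 :> ratfun by rewrite tofrac_eq0.
have value (f : ratfun) (a b N : {poly R}) t : horner_cpx b t != 0 ->
    horner_cpx D t != 0 -> f = tofrac a / tofrac b ->
    f * tofrac D = tofrac N ->
    horner_cpx a t / horner_cpx b t = horner_cpx N t / horner_cpx D t.
  move=> bt Dt -> fD; apply/eqP; rewrite eqr_div // -!hcM; apply/eqP.
  congr horner_cpx; apply/eqP; rewrite -tofrac_eq !tofracM -fD; apply/eqP.
  have tb0 : tofrac b != 0 :> ratfun.
    rewrite tofrac_eq0; apply: contraNneq bt => ->.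
    by rewrite /horner_cpx rmorph0 horner0.
  by rewrite mulrAC divfK.
exists (map_poly (real_complex R) A), (map_poly (real_complex R) B),
  (map_poly (real_complex R) D).
split; first by rewrite map_poly_eq0.
- move=> t Dt; apply: contrapT => /forallNP noAB.
  have At : root (map_poly (real_complex R) A) t.
    by have /negP := noAB (inord 1); rewrite negbK (tnth_nth 0) inordK.
  have Bt : root (map_poly (real_complex R) B) t.
    by have /negP := noAB (inord 2); rewrite negbK (tnth_nth 0) inordK.
  have : root (map_poly (real_complex R) (gcdp (gcdp A B) D)) t.
    by rewrite !gcdp_map !root_gcd At Bt /= /root Dt.
  have /eqP/size_poly1P[c c0 ->] := cop.
  by rewrite map_polyC rootC fmorph_eq0 (negbTE c0).
- rewrite eqEsubset; split=> P.
    move=> [t [_ [_ [[a [b [bt pE ->]]] [c [d [dt qE ->]]] ->]]]].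
    have b0 : b != 0.
      by apply: contraNneq bt => ->; rewrite /horner_cpx rmorph0 horner0.
    have d0 : d != 0.
      by apply: contraNneq dt => ->; rewrite /horner_cpx rmorph0 horner0.
    have Dt : horner_cpx D t != 0.
      have /dvdpP[k kE] : D %| b * d.
        apply: (Dmin (a * d) (b * c)); split; first exact: mulf_neq0.
          by rewrite pE !tofracM mulrA divfK ?tofrac_eq0.
        by rewrite qE !tofracM mulrCA divfK ?tofrac_eq0.
      have : horner_cpx (b * d) t != 0 by rewrite hcM mulf_neq0.
      by apply: contraNneq => Dt; rewrite kE hcM Dt mulr0.
    exists t => //; rewrite curve_point3 horner0 mul0r.
    by rewrite (value p a b A) // (value q c d B).
  move=> [t Dt ->].
  exists t, (horner_cpx A t / horner_cpx D t), (horner_cpx B t / horner_cpx D t).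
  split; last by rewrite curve_point3 horner0 mul0r.
  + by exists A, D; split=> //; rewrite -pD mulfK.
  + by exists B, D; split=> //; rewrite -qD mulfK.
Qed.

Lemma critical_point_unique p q P Q :
  critical_point p q P -> critical_point p q Q -> P = Q.
Proof.
have [A [B [D [D0 nb E]]]] := profile_param p q.
rewrite /critical_point /profile_curve E => -[clP nP] [clQ nQ].
rewrite (missed_point_at_infinity D0 nb clP nP).
by rewrite (missed_point_at_infinity D0 nb clQ nQ).
Qed.

Lemma profile_chain_free p q : chain_free (profile_curve p q).
Proof.
have [A [B [D [D0 nb E]]]] := profile_param p q.
by rewrite /profile_curve E; apply: curve_chain_free.
Qed.

Lemma mirror_curve_flip p q y z :
  profile_curve p q [tuple 0; y; z] -> mirror_curve p q [tuple 0; - y; z].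
Proof.
pose g : 3.-tuple {mpoly C[3]} :=
  [tuple 'X_ord0; - 'X_(inord 1); 'X_(inord 2)].
have gE a b c :
    [tuple (tnth g i).@[tnth [tuple a; b; c]] | i < 3] = [tuple a; - b; c].
  apply: eq_tuple3; rewrite tnth_mktuple (tnth_nth 0) ?inordK //=;
  by rewrite ?mevalN mevalXU (tnth_nth 0) ?inordK.
rewrite -gE; apply: zariski_closure_image => _ [t [u [v [pu qv ->]]]].
by rewrite gE; exists t, (- u), v; split=> //; apply: ratfun_valueN.
Qed.

(** Rotating by a fixed parameter is a linear map of the meridian plane, so it
    carries the closure of the reached points into S, missed point included. *)
Lemma circ_sub_revolution p q y z :
  profile_curve p q [tuple 0; y; z] -> circ y z `<=` revolution_surface p q.
Proof.
move=> yz; apply: zariski_closure_sub; first exact: zariski_closure_closed.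
move=> _ [s [s0 ->]].
pose g : 3.-tuple {mpoly C[3]} :=
  [tuple (2 * s / (1 + s ^+ 2)) *: 'X_(inord 1);
         ((1 - s ^+ 2) / (1 + s ^+ 2)) *: 'X_(inord 1); 'X_(inord 2)].
have gE a b c :
    [tuple (tnth g i).@[tnth [tuple a; b; c]] | i < 3] = rotate s b c.
  apply: eq_tuple3; rewrite tnth_mktuple (tnth_nth 0) ?inordK //=;
  by rewrite ?mevalZ mevalXU (tnth_nth 0) ?inordK.
rewrite -(gE 0); apply: zariski_closure_image yz => _ [t [u [v [pu qv ->]]]].
by rewrite gE; exists s, t, u, v.
Qed.

(** The limit of the parametrization at infinity: with u = 1 / s it becomes the
    point of parameter u = 0. *)
Lemma circ_antipode y z : circ y z [tuple 0; - y; z].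
Proof.
move=> f fcirc; rewrite /vanishes_at.
pose A := tnth
  [tuple (2 * y) *: 'X; y *: ('X^2 - 1); z *: (1 + 'X^2) : {poly C}].
pose D : {poly C} := 1 + 'X^2.
have D1 : D.[0] = 1 by rewrite /D !hornerE expr0n addr0.
have D0 : D != 0.
  by apply/eqP => DE; move/eqP: D1; rewrite DE horner0 eq_sym oner_eq0.
have cE u : curve_point A D u = [tuple 2 * y * u / (1 + u ^+ 2);
    y * (u ^+ 2 - 1) / (1 + u ^+ 2); z * (1 + u ^+ 2) / (1 + u ^+ 2)].
  by rewrite curve_point3 /D !hornerE.
have -> : [tuple 0; - y; z] = curve_point A D 0.
  by rewrite cE expr0n /= addr0 !divr1 mulr0 sub0r mulrN !mulr1.
apply: (@vanish_cofinite _ A D f [:: 0]); rewrite ?D1 ?oner_eq0 // => u.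
rewrite inE => u0; rewrite /D !hornerE => Du; apply: fcirc; exists u^-1.
have E : 1 + u^-1 ^+ 2 = (1 + u ^+ 2) / u ^+ 2 by field.
split; first by rewrite E mulf_neq0 // invr_eq0 expf_neq0.
rewrite cE /rotate; have ui0 : 1 + u^-1 ^+ 2 != 0.
  by rewrite E mulf_neq0 // invr_eq0 expf_neq0.
by congr [tuple _; _; _]; rewrite ?E; field; rewrite ?u0 ?Du.
Qed.

Lemma circ_chain_free y z : y != 0 -> chain_free (circ y z).
Proof.
move=> y0.
pose A := tnth
  [tuple (2 * y) *: 'X; y *: (1 - 'X^2); z *: (1 + 'X^2) : {poly C}].
pose D : {poly C} := 1 + 'X^2.
have DE t : D.[t] = 1 + t ^+ 2 by rewrite /D !hornerE.
have D0 : D != 0.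
  apply/eqP => D0; have := DE 0; rewrite D0 horner0 expr0n addr0 => /eqP.
  by rewrite eq_sym oner_eq0.
have cE t : D.[t] != 0 -> curve_point A D t = rotate t y z.
  rewrite DE => Dt; rewrite curve_point3 DE !hornerE /rotate.
  by congr [tuple _; _; _]; field.
have -> : circ y z = zariski_closure (curve_image A D).
  rewrite /circ; congr zariski_closure; rewrite eqEsubset; split=> P.
    by move=> [s [s0 ->]]; exists s; rewrite -?DE in s0 *; rewrite ?cE.
  by move=> [t Dt ->]; exists t; rewrite -DE cE.
apply: curve_chain_free => // t; rewrite DE => Dt; exists ord0.
rewrite /A (tnth_nth 0) /= !hornerE !mulf_neq0 ?pnatr_eq0 //.
by apply: contra_eq_neq Dt => ->; rewrite expr0n addr0 oner_eq0.
Qed.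

(** The parameter s = x / (y + r) is the tangent of half the angle of
    (x, y) / r; it satisfies 1 + s^2 = 2 r / (y + r). *)
Lemma rotate_covers x y z r : x ^+ 2 + y ^+ 2 = r ^+ 2 -> r != 0 -> y != - r ->
  exists s, 1 + s ^+ 2 != 0 /\ [tuple x; y; z] = rotate s r z.
Proof.
move=> xy r0; rewrite -addr_eq0 => yr; exists (x / (y + r)).
have sE : 1 + (x / (y + r)) ^+ 2 = 2 * r / (y + r).
  by rewrite expr_div_n -[x ^+ 2](addrK (y ^+ 2)) xy; field.
have two0 : 2 != 0 :> C by rewrite pnatr_eq0.
split; first by rewrite sE !mulf_neq0 // invr_eq0.
rewrite /rotate sE expr_div_n -[x ^+ 2](addrK (y ^+ 2)) xy.
by congr [tuple _; _; _]; field; rewrite ?two0 ?r0 ?yr.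
Qed.

(** If both points were off the profile curve, some equation h of the curve
    would be nonzero at both, and h(r, z) h(- r, z), read as a polynomial in
    x^2 + y^2 and z, would vanish on S but not at the given point. *)
Lemma revolution_section p q x y z r : r ^+ 2 = x ^+ 2 + y ^+ 2 ->
    revolution_surface p q [tuple x; y; z] ->
  profile_curve p q [tuple 0; r; z] \/ profile_curve p q [tuple 0; - r; z].
Proof.
move=> rE Sxyz; apply: contrapT => /not_orP[].
move=> /existsNP[f /not_implyP[fI fr]] /existsNP[g /not_implyP[gI gr]].
have [h [hI /eqP hr /eqP hNr]] : exists h,
    [/\ vanishing_ideal (profile_reachable p q) h,
    h.@[tnth [tuple 0; r; z]] <> 0 & h.@[tnth [tuple 0; - r; z]] <> 0].
  have [fNr|/contrapT fNr] := pselect (~ vanishes_at f [tuple 0; - r; z]).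
    by exists f; split; [exact: fI|exact: fr|exact: fNr].
  have [gNr|/contrapT gNr] := pselect (~ vanishes_at g [tuple 0; r; z]).
    by exists g; split; [exact: gI|exact: gNr|exact: gr].
  exists (f + g); split.
  - move=> P XP; rewrite /vanishes_at mevalD.
    by rewrite (fI P XP : f.@[_] = 0) (gI P XP : g.@[_] = 0) addr0.
  - by rewrite mevalD (gNr : g.@[_] = 0) addr0; exact: fr.
  - by rewrite mevalD (fNr : f.@[_] = 0) add0r; exact: gr.
have [a [b hE]] := mpoly_even_odd h.
pose F := a * a - ('X_ord0 ^+ 2 + 'X_(inord 1) ^+ 2) * b * b.
have FE u v w s : s ^+ 2 = u ^+ 2 + v ^+ 2 -> F.@[tnth [tuple u; v; w]]
    = h.@[tnth [tuple 0; s; w]] * h.@[tnth [tuple 0; - s; w]].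
  move=> sE; rewrite (hE u v w s sE) (hE u v w (- s)) ?sqrrN //.
  rewrite /F !(mevalB, mevalD, mevalM, rmorphXn) !mevalXU.
  rewrite !(tnth_nth 0) inordK //=.
  by rewrite -sE; ring.
have : vanishes_at F [tuple x; y; z].
  apply: Sxyz => _ [s [t [u [v [s0 pu qv ->]]]]].
  rewrite /vanishes_at (FE _ _ _ u); last by field.
  by rewrite hI ?mul0r //; exists t, u, v.
rewrite /vanishes_at (FE x y z r rE) => /eqP.
by rewrite mulf_eq0 (negbTE hr) (negbTE hNr).
Qed.

(** Reality of x and y is what makes r = 0 force x = y = 0; over the complex
    numbers the isotropic lines x^2 + y^2 = 0 would be missed as well. *)
Lemma unreached_on_mirror p q (x y : R) z r : r ^+ 2 = x%:C ^+ 2 + y%:C ^+ 2 ->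
    profile_curve p q [tuple 0; r; z] ->
    ~ revolution_reachable p q [tuple x%:C; y%:C; z] ->
  mirror_curve p q [tuple x%:C; y%:C; z] \/
  r != 0 /\ ~ profile_reachable p q [tuple 0; r; z].
Proof.
move=> rE Cr unreached.
(* The opposite point (0, - r, z); the case r = 0 falls here too, as x and y
   are real. *)
have [yr|yr] := eqVneq y%:C (- r).
  left; have -> := circle_pole rE yr.
  by rewrite yr; apply: mirror_curve_flip.
have r0 : r != 0.
  apply: contraNneq yr => r0; move/esym/eqP: rE; rewrite r0 expr0n oppr0 /=.
  rewrite -!rmorphXn -rmorphD fmorph_eq0 paddr_eq0 ?sqr_ge0 // !sqrf_eq0.
  by case/andP=> _ /eqP ->.
right; split=> // -[t [u [v [pu qv /(congr1 val)[ur vz]]]]]; apply: unreached.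
have [s [s0 ->]] := rotate_covers z (esym rE) r0 yr.
by exists s, t, r, z; rewrite ur vz.
Qed.

Lemma mirror_sub_revolution p q : mirror_curve p q `<=` revolution_surface p q.
Proof.
apply: zariski_closure_sub; first exact: zariski_closure_closed.
move=> _ [t [y [z [py qz ->]]]]; apply: (@circ_sub_revolution p q (- y) z).
  apply: sub_zariski_closure; exists t, (- y), z; split=> //.
  by rewrite -[p]opprK; apply: ratfun_valueN.
by have := @circ_antipode (- y) z; rewrite opprK.
Qed.

Lemma mirror_dim p q : dim_lt 2 (mirror_curve p q).
Proof.
rewrite -[mirror_curve p q]setUid.
by apply: dim_lt2_setU;
  do ?[exact: zariski_closure_closed | exact: profile_chain_free].
Qed.

End Revolution.

Theorem theorem2p3 (R : realType) (p q : {fraction {poly R}})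
    (p_neq0 : p <> 0) (q_nonconst : ~ ratfun_const q)
    (rP_proper : profile_proper p q)
    (nonsymmetric : profile_curve p q <> mirror_curve p q) :
  (profile_normal p q -> real_critical_set p q (mirror_curve p q)) /\
  (~ profile_normal p q ->
   forall b c : R[i], critical_point p q [tuple 0; b; c] ->
     (profile_curve p q [tuple 0; - b; c] ->
      real_critical_set p q (mirror_curve p q)) /\
     (~ profile_curve p q [tuple 0; - b; c] ->
      real_critical_set p q (mirror_curve p q `|` circ b c))).
Proof.
have section (x y z : R) : let P := [tuple x%:C; y%:C; z%:C] in
    revolution_surface p q P -> ~ revolution_reachable p q P ->
    mirror_curve p q P \/ exists r, [/\ r ^+ 2 = x%:C ^+ 2 + y%:C ^+ 2,
      r != 0 & critical_point p q [tuple 0; r; z%:C]].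
  move=> P SP nP; pose r := sqrtC (x%:C ^+ 2 + y%:C ^+ 2).
  have rE : r ^+ 2 = x%:C ^+ 2 + y%:C ^+ 2 by rewrite sqrtCK.
  have rNE : (- r) ^+ 2 = x%:C ^+ 2 + y%:C ^+ 2 by rewrite sqrrN.
  have [Cr|Cr] := revolution_section rE SP.
    have [|[r0 nr]] := unreached_on_mirror rE Cr nP; first by left.
    by right; exists r.
  have [|[r0 nr]] := unreached_on_mirror rNE Cr nP; first by left.
  by right; exists (- r).
split=> [normal|_ b c bc].
  split; [exact: mirror_sub_revolution|exact: mirror_dim|].
  by move=> x y z P SP /(section _ _ _ SP)[//|[r [_ _ [/normal]]]].
have bcE (r : R[i]) z : critical_point p q [tuple 0; r; z] -> r = b /\ z = c.
  by move=> /critical_point_unique/(_ bc)/(congr1 val)[-> ->].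
split=> bNc.
  split; [exact: mirror_sub_revolution|exact: mirror_dim|].
  move=> x y z P SP nP.
  have [//|[r [rE r0 /bcE[rb zc]]]] := section _ _ _ SP nP.
  rewrite /P zc in nP *; rewrite rb in rE r0.
  have rNE : (- b) ^+ 2 = x%:C ^+ 2 + y%:C ^+ 2 by rewrite sqrrN.
  (* Over (0, - b, c), which differs from the only missed point (0, b, c). *)
  have [//|[_ nb]] := unreached_on_mirror rNE bNc nP.
  have [/eqP + _] := bcE _ _ (conj bNc nb).
  by rewrite eqNr (negbTE r0).
have b0 : b != 0.
  by apply/eqP => b0; apply: bNc; case: bc => + _; rewrite b0 oppr0.
split.
- move=> P [|]; [exact: mirror_sub_revolution|].
  by apply: circ_sub_revolution; case: bc.
- apply: dim_lt2_setU; try exact: zariski_closure_closed.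
    exact: profile_chain_free.
  exact: circ_chain_free.
move=> x y z P SP nP.
have [|[r [rE r0 /bcE[rb zc]]]] := section _ _ _ SP nP; [by left|right].
rewrite /P zc {zc}; rewrite rb in rE.
have [yb|yb] := eqVneq y%:C (- b).
  by rewrite (circle_pole rE yb) yb; apply: circ_antipode.
have [s [s0 ->]] := rotate_covers c (esym rE) b0 yb.
by apply: sub_zariski_closure; exists s.
Qed.
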